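(* Let $D'\geq 3$ and $n'\geq 1$ be integers with $n'\geq D'\cdot 2^{12}/3$. Then there exists a connected port-labeled graph $G$ with at most $n'$ nodes and diameter at most $D'$ which contains two nodes $a,b$ such that $\mathcal{V}(a)\neq\mathcal{V}(b)$, but $\mathcal{V}_t(a)=\mathcal{V}_t(b)$ for every integer $t$ with $0\le t\leq \frac{D'-5}{6}\log_2\frac{n'}{D'}-0.41D'$.
   Context: A port-labeled graph is a simple undirected graph $G$ in which, for every node $v$ of degree $k=\deg_G(v)$, the edges incident to $v$ are labeled bijectively by the port numbers $\{1,\ldots,k\}$; write $\lambda(u,v)$ for the port number at $u$ of the edge $\{u,v\}$. The truncated view $\mathcal{V}_l(v)$ of a node $v$ is the rooted port-labeled tree defined recursively: $\mathcal{V}_0(v)$ is a single root node $x_0$; $\mathcal{V}_{l+1}(v)$ has root $x_0$ with one child $x_i$ for each neighbor $v_i$ of $v$, the tree edge $\{x_0,x_i\}$ carrying port number $\lambda(v,v_i)$ at $x_0$ and $\lambda(v_i,v)$ at $x_i$, and the subtree rooted at $x_i$ is $\mathcal{V}_l(v_i)$. The view $\mathcal{V}(v)$ is the infinite rooted port-labeled tree whose truncation to depth $l$ is $\mathcal{V}_l(v)$ for every $l\ge 0$. The diameter of $G$ is the maximum over pairs of nodes of their shortest-path distance. *)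

(* Defs.v *)
From HB Require Import structures.
From mathcomp Require Import all_boot all_order all_algebra.
From mathcomp Require Import all_classical all_reals exp.

Set Implicit Arguments.
Unset Strict Implicit.
Unset Printing Implicit Defensive.
Import Order.TTheory GRing.Theory Num.Theory.

Local Open Scope classical_set_scope.
Local Open Scope nat_scope.

(** [port v u] is the port number at [v] of the edge [{v, u}]; its value is
    meaningless when [v] and [u] are not adjacent. *)
Record port_graph := PortGraph {
  vertex :> finType;
  adj : rel vertex;
  port : vertex -> vertex -> nat;
  adj_sym : symmetric adj;
  adj_irrefl : irreflexive adj;
  port_bij : forall v : vertex,
    set_bij [set u | adj v u] [set p | 1 <= p <= #|adj v|] (port v)
}.

Section Distance.
Variable G : port_graph.

Definition connected_graph : Prop := forall u v : G, connect (@adj G) u v.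

Definition walk_of_length (l : nat) (u v : G) : bool :=
  [exists p : l.-tuple G, path (@adj G) u p && (last u p == v)].

(** A shortest walk has length less than [#|G|], so only those lengths are
    searched; the value is [#|G|] if [v] cannot be reached from [u]. *)
Definition dist (u v : G) : nat :=
  \big[minn/#|G|]_(l < #|G| | walk_of_length l u v) l.

Definition diameter : nat := \max_(u : G) \max_(v : G) dist u v.

End Distance.

(** Rooted port-labeled trees, finite or infinite.  The edges from the root to
    its children carry distinct ports at the root, so the children are indexed
    by these ports: [children t p = Some (q, s)] means that the edge with port
    [p] at the root of [t] leads to a child at which it has port [q] and whose
    subtree is [s]; [children t p = None] means that there is no such edge. *)
#[projections(primitive)]
CoInductive ptree := PNode { children : nat -> option (nat * ptree) }.

(** A relation between (sub)trees that matches children reached through the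
    same port. *)
Definition bisimulation (B : ptree -> ptree -> Prop) : Prop :=
  forall s t : ptree, B s t -> forall p : nat,
    omap fst (children s p) = omap fst (children t p) /\
    forall (q q' : nat) (s' t' : ptree),
      children s p = Some (q, s') -> children t p = Some (q', t') -> B s' t'.

(** Equality of rooted port-labeled trees, that is, isomorphism preserving the
    root and all ports.  Such an isomorphism must send each child to the child
    reached through the same port, and so amounts to a bisimulation relating
    the two trees.  Leibniz equality would be too fine on infinite trees. *)
Definition tree_iso (s t : ptree) : Prop :=
  exists2 B : ptree -> ptree -> Prop, bisimulation B & B s t.

Definition leaf : ptree := PNode (fun _ => None).

Fixpoint truncate (l : nat) (t : ptree) : ptree :=
  if l is k.+1 then
    PNode (fun p => if children t p is Some (q, s) then Some (q, truncate k s)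
                    else None)
  else leaf.

Section Views.
Variable G : port_graph.

Definition neighbor (v : G) (p : nat) : option G :=
  [pick u | adj v u && (port v u == p)].

Fixpoint truncated_view (l : nat) (v : G) : ptree :=
  if l is k.+1 then
    PNode (fun p => if neighbor v p is Some u
                    then Some (port u v, truncated_view k u) else None)
  else leaf.

CoFixpoint view (v : G) : ptree :=
  PNode (fun p => if neighbor v p is Some u
                  then Some (port u v, view u) else None).

End Views.

Lemma tree_isoP (s t : ptree) :
  tree_iso s t <-> forall p : nat,
    omap fst (children s p) = omap fst (children t p) /\
    forall (q q' : nat) (s' t' : ptree),
      children s p = Some (q, s') -> children t p = Some (q', t') ->
      tree_iso s' t'.
Proof.
split=> [[B Bb Bst] p|H].
  have [Ep Bp] := Bb _ _ Bst p; split=> // q q' s' t' Es Et.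
  by exists B => //; apply: Bp Es Et.
exists (fun x y => tree_iso x y \/ (x = s /\ y = t)); last by right.
move=> x y [[B Bb Bxy]|[-> ->]] p.
  have [Ep Bp] := Bb _ _ Bxy p; split=> // q q' s' t' Es Et.
  by left; exists B => //; apply: Bp Es Et.
by have [Ep Hp] := H p; split=> // q q' s' t' Es Et; left; apply: Hp Es Et.
Qed.

(** The next two lemmas characterize [view v], up to [tree_iso], as the tree
    whose truncation to every depth [l] is [truncated_view l v]. *)
Lemma truncate_view (G : port_graph) (l : nat) (v : G) :
  tree_iso (truncate l (view v)) (truncated_view l v).
Proof.
elim: l v => [|l IH] v; apply/tree_isoP => p //=.
by case: (neighbor v p) => //= u; split=> // q q' s' t' [_ <-] [_ <-].
Qed.

Lemma view_unique (G : port_graph) (v : G) (t : ptree) :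
  (forall l, tree_iso (truncate l t) (truncated_view l v)) ->
  tree_iso t (view v).
Proof.
move=> Ht; exists (fun s w => exists2 u : G, w = view u &
  forall l, tree_iso (truncate l s) (truncated_view l u)); last by exists v.
move=> {v t Ht} s _ [v -> Hs] p; split.
  have /tree_isoP /(_ p) [/= + _] := Hs 1.
  by case: (children s p) => [[q s']|]; case: (neighbor v p).
move=> q q' s' t' Es /=; case En: (neighbor v p) => [u|] // [_ <-].
exists u => // l; have /tree_isoP /(_ p) [_] := Hs l.+1.
by rewrite /= Es En; apply.
Qed.

Local Open Scope ring_scope.

Definition log2 (R : realType) (x : R) : R := ln x / ln 2.

(* Main.v *)
Require Import Defs.
From mathcomp Require Import all_boot all_order all_algebra.
From mathcomp Require Import all_classical all_reals exp.
From mathcomp Require Import zify lra.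

(** A vertex is a position on a cycle of length [M] together with a string of
    [K] bits; one turn around the cycle rotates the string.  At position [0] the
    strings are pairwise joined by edges labelled with their difference, except
    that two strings whose first bits are both [1] are not joined, so that the
    degree there reveals the first bit.  This keeps the diameter at most [2M],
    and following a difference edge never brings other bits of the string into
    the first place.  Only walking along the cycle does: the pairs
    (bit, position) form a cycle of length [KM] and a bit is recognized only
    after as many rounds as its distance to the pair (first bit, position [0]).
    The bit at distance [KM/2] separates two vertices with equal views up to
    that depth, while there are only [M 2^K] vertices. *)

Set Implicit Arguments.
Unset Strict Implicit.
Unset Printing Implicit Defensive.
Import Order.TTheory GRing.Theory Num.Theory.

Local Open Scope nat_scope.

Lemma tree_iso_sym (s t : ptree) : tree_iso s t -> tree_iso t s.
Proof.
case=> B bB Bst; exists (fun x y => B y x) => // x y /bB Byx p.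
by have [-> Bp] := Byx p; split=> // q q' s' t' Ex Ey; apply: Bp Ey Ex.
Qed.

(** * Views and walks *)

Section Views.
Variable G : port_graph.
Implicit Types u v w : G.

Lemma port_range v u : adj v u -> 1 <= port v u <= #|adj v|.
Proof. by have [/(_ u) + _ _] := port_bij v; apply. Qed.

Lemma port_inj v u w : adj v u -> adj v w -> port v u = port v w -> u = w.
Proof. by have [_ + _] := port_bij v => /(_ u w); rewrite !inE; apply. Qed.

Lemma port_surj v p : 1 <= p <= #|adj v| -> exists2 u, adj v u & port v u = p.
Proof. by have [_ _ /(_ p)] := port_bij v => + pP => /(_ pP) [u]; exists u. Qed.

Lemma neighborP v u p :
  reflect (adj v u /\ port v u = p) (neighbor v p == Some u).
Proof.
rewrite /neighbor; case: pickP => [w /andP[vw /eqP <-]|noN] /=.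
  apply: (iffP eqP) => [[<-] //|[vu]]; move/port_inj->; done.
by apply: (iffP idP) => // -[vu /eqP pu]; have := noN u; rewrite vu pu.
Qed.

Lemma view_iso_step v v' u : tree_iso (view v) (view v') -> adj v u ->
  exists u', [/\ adj v' u', port v' u' = port v u & tree_iso (view u) (view u')].
Proof.
move=> /tree_isoP /(_ (port v u)) /= + vu.
have /eqP -> : neighbor v (port v u) == Some u by apply/neighborP.
case Eu: (neighbor v' _) => [u'|] [//= _ /(_ _ _ _ _ erefl erefl) iso].
by have /eqP/neighborP[] := Eu; exists u'.
Qed.

(** The degree is the largest port, and the edge through it must have a counterpart at the other
    vertex. *)
Lemma view_iso_degree v v' : tree_iso (view v) (view v') -> #|adj v| = #|adj v'|.
Proof.
suff le w w' : tree_iso (view w) (view w') -> #|adj w| <= #|adj w'|.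
  by move=> iso; apply/eqP; rewrite eqn_leq !le //; apply: tree_iso_sym.
move=> iso; case: (posnP #|adj w|) => [-> //|dw].
have [|u wu <-] := @port_surj w #|adj w|; first by rewrite dw leqnn.
by have [u' [/port_range /andP[_ +] <-]] := view_iso_step iso wu.
Qed.

(** A bisimulation graded by depth: ports fill an interval from 1, so equal degrees give the same
    ports at both roots, and each edge may lose one level of [E]. *)
Lemma truncated_view_iso (E : nat -> G -> G -> Prop) :
  (forall l v v', E l v v' -> #|adj v| = #|adj v'|) ->
  (forall l v v' u u', E l.+1 v v' -> adj v u -> adj v' u' ->
     port v u = port v' u' -> port u v = port u' v' /\ E l u u') ->
  forall l v v', E l v v' -> tree_iso (truncated_view l v) (truncated_view l v').
Proof.
move=> Edeg Estep; elim=> [|l IH] v v' Evv'; apply/tree_isoP => p //=.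
case Eu: (neighbor v p) => [u|]; case Eu': (neighbor v' p) => [u'|] //=.
- have /eqP/neighborP[vu pu] := Eu; have /eqP/neighborP[vu' pu'] := Eu'.
  have [-> /IH iso] := Estep _ _ _ _ _ Evv' vu vu' (etrans pu (esym pu')).
  by split=> // q q' s t [_ <-] [_ <-].
- have /eqP/neighborP[vu pu] := Eu; have := port_range vu.
  rewrite pu (Edeg _ _ _ Evv') => /port_surj[w vw pw].
  by have /neighborP : adj v' w /\ port v' w = p by []; rewrite Eu'.
- have /eqP/neighborP[vu pu] := Eu'; have := port_range vu.
  rewrite pu -(Edeg _ _ _ Evv') => /port_surj[w vw pw].
  by have /neighborP : adj v w /\ port v w = p by []; rewrite Eu.
Qed.

Definition within (d : nat) u v :=
  exists p, [/\ path (@adj G) u p, last u p = v & size p <= d].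

Lemma within0 u : within 0 u u.
Proof. by exists [::]. Qed.

Lemma within1 u v : adj u v -> within 1 u v.
Proof. by move=> uv; exists [:: v]; rewrite /= uv. Qed.

Lemma within_leq d d' u v : d <= d' -> within d u v -> within d' u v.
Proof. by move=> dd' [p [Pp lp sp]]; exists p; split=> //; apply: leq_trans dd'. Qed.

Lemma within_trans d d' u v w :
  within d u v -> within d' v w -> within (d + d') u w.
Proof.
move=> [p [Pp lp sp]] [q [Pq lq sq]]; exists (p ++ q).
by rewrite cat_path last_cat size_cat lp Pp Pq lq leq_add.
Qed.

Lemma within_connected d : (forall u v, within d u v) -> connected_graph G.
Proof. by move=> H u v; have [p [Pp <- _]] := H u v; apply/connectP; exists p. Qed.

(** Since [dist] searches only lengths below [#|G|], the walk is first shortened to a path without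
    repeated vertices. *)
Lemma within_diameter d : (forall u v, within d u v) -> diameter G <= d.
Proof.
move=> H; apply/bigmax_leqP => u _; apply/bigmax_leqP => v _.
have [p [Pp lp sp]] := H u v; case: (shortenP Pp) lp => q Pq Uq sub lq.
have sq : size q < #|G|.
  by have := max_card (mem (u :: q)); rewrite (card_uniqP Uq).
have W : walk_of_length (Ordinal sq) u v.
  by apply/existsP; exists (in_tuple q); rewrite /= Pq; apply/eqP.
suff le_sq : dist u v <= size q.
  apply: leq_trans le_sq (leq_trans _ sp).
  by apply: uniq_leq_size => //; case/andP: Uq.
have := mem_index_enum (Ordinal sq); rewrite /dist.
elim: (index_enum _) => // i r IH; rewrite inE big_cons => /predU1P[<-|/IH le_sq].
  by rewrite W geq_minl.
by case: ifP => // _; rewrite geq_min le_sq orbT.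
Qed.

End Views.

(** * Ports obtained by ranking edge labels *)

Section LabelledGraph.
Variables (V L : finType) (e : rel V) (lab : V -> V -> L).
Hypothesis e_sym : symmetric e.
Hypothesis e_irr : irreflexive e.
Hypothesis lab_inj : forall v u w, e v u -> e v w -> lab v u = lab v w -> u = w.

Definition labels v : {set L} := [set lab v u | u in e v].

(** Counting with [<=] makes ranks start at 1, as port numbers do. *)
Definition rank_in (A : {set L}) (c : L) :=
  #|[set b in A | enum_rank b <= enum_rank c]|.

Definition label_port v u := rank_in (labels v) (lab v u).

Lemma rank_in_ltn (A : {set L}) b c : c \in A ->
  enum_rank b < enum_rank c -> rank_in A b < rank_in A c.
Proof.
move=> cA bc; apply/proper_card/properP; split.
  apply/fintype.subsetP => a; rewrite !inE => /andP[-> ab] /=.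
  exact: leq_trans ab (ltnW bc).
by exists c; rewrite !inE cA //= -ltnNge.
Qed.

Lemma rank_in_inj (A : {set L}) : {in A &, injective (rank_in A)}.
Proof.
move=> b c bA cA E; apply/enum_rank_inj/val_inj => /=.
by case: (ltngtP (enum_rank b) (enum_rank c)) => // /rank_in_ltn;
  [move=> /(_ A cA)|move=> /(_ A bA)]; rewrite E ltnn.
Qed.

Lemma lab_labels v u : e v u -> lab v u \in labels v.
Proof. by move=> vu; apply: imset_f. Qed.

Lemma card_labels v : #|labels v| = #|e v|.
Proof. by apply: card_in_imset => u w; apply: lab_inj. Qed.

Lemma label_port_bij v :
  set_bij [set u | e v u]%classic [set p | 1 <= p <= #|e v|]%classic (label_port v).
Proof.
have range u : e v u -> 1 <= label_port v u <= #|e v|.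
  move=> vu; rewrite -card_labels; apply/andP; split.
    by apply/card_gt0P; exists (lab v u); rewrite inE lab_labels /=.
  by apply/subset_leq_card/fintype.subsetP => c; rewrite inE => /andP[].
have inj u w : e v u -> e v w -> label_port v u = label_port v w -> u = w.
  by move=> vu vw E; apply: lab_inj (rank_in_inj _ _ E) => //; apply: lab_labels.
split=> [u /range //|u w|p /= pP].
  by rewrite !inE; apply: inj.
(* Surjectivity by counting: the ports in use are [#|e v|] distinct numbers in an interval of that
   size. *)
pose s := [seq label_port v u | u <- enum (e v)].
have Us : uniq s.
  rewrite map_inj_in_uniq ?enum_uniq // => u w; rewrite !mem_enum; exact: inj.
have sub : {subset s <= iota 1 #|e v|}.
  move=> q /mapP[u]; rewrite mem_enum => /range /andP[q1 qd] ->.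
  by rewrite mem_iota q1 add1n ltnS.
have [|_ sE] := uniq_min_size Us sub; first by rewrite size_iota size_map cardE.
have : p \in s by rewrite sE mem_iota add1n ltnS.
by case/mapP => u; rewrite mem_enum => vu ->; exists u.
Qed.

Definition label_graph : port_graph := PortGraph e_sym e_irr label_port_bij.

(** Ranking is injective on a fixed label set, so vertices with the same label set translate ports
    into labels in the same way. *)
Lemma label_port_lab v v' u u' : labels v = labels v' -> e v u -> e v' u' ->
  label_port v u = label_port v' u' -> lab v u = lab v' u'.
Proof.
move=> Lv vu vu'; rewrite /label_port -Lv => /rank_in_inj; apply.
  exact: lab_labels.
by rewrite Lv lab_labels.
Qed.

End LabelledGraph.

(** * Bit strings rotating around a cycle *)

Section CycleGraph.
Variables m k : nat.
(* [3 <= M] keeps [next v] and [prev v] distinct; [2 <= K] provides a nonzero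
   difference that does not change the first bit. *)
Local Notation M := m.+3.
Local Notation K := k.+2.

Definition bits := {ffun 'I_K -> bool}.
Definition cvertex := ('I_M * bits)%type.
Implicit Types (v u : cvertex) (x y : bits) (i : 'I_K) (j : 'I_M).

Definition xor x y : bits := [ffun i => x i (+) y i].

(** Crossing from the last position to 0 moves bit [i] to place [ordS i], so each forward step
    raises [i * M + j] by one modulo [K * M]. *)
Definition next v : cvertex :=
  (ordS v.1, if v.1 == ord_max then [ffun i => v.2 (ord_pred i)] else v.2).

Definition prev v : cvertex :=
  (ord_pred v.1, if v.1 == ord0 then [ffun i => v.2 (ordS i)] else v.2).

Definition chord v u :=
  [&& v.1 == ord0, u.1 == ord0, v.2 != u.2 & ~~ (v.2 ord0 && u.2 ord0)].

Definition cadj v u := [|| u == next v, u == prev v | chord v u].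

Definition clab v u : bool + bits :=
  if u == next v then inl true
  else if u == prev v then inl false else inr (xor v.2 u.2).

Lemma val_ordS j : val (ordS j) = if j == ord_max then 0 else j.+1.
Proof.
rewrite -val_eqE /=; have := ltn_ord j; case: eqP => [->|jM lt_j].
  by rewrite modnn.
by rewrite modn_small //; lia.
Qed.

Lemma val_ord_pred n (i : 'I_n.+1) :
  val (ord_pred i) = if i == ord0 then n else i.-1.
Proof.
rewrite -val_eqE /=; have := ltn_ord i; case: eqP => [-> _|i0 lt_i].
  by rewrite add0n modn_small.
have -> : (i + n.+1).-1 = i.-1 + n.+1 by lia.
by rewrite modnDr modn_small //; lia.
Qed.

Lemma ordS_eq0 j : (ordS j == ord0) = (j == ord_max).
Proof. by rewrite -(inj_eq val_inj) val_ordS; case: (j == ord_max). Qed.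

Lemma ord_pred_eq_max j : (ord_pred j == ord_max) = (j == ord0).
Proof. by rewrite -ordS_eq0 ord_predK. Qed.

Lemma nextK : cancel next prev.
Proof.
case=> j x; rewrite /prev /next /= ordSK ordS_eq0; congr (_, _).
by case: eqP => // _; apply/ffunP => i; rewrite !ffunE ordSK.
Qed.

Lemma prevK : cancel prev next.
Proof.
case=> j x; rewrite /prev /next /= ord_predK ord_pred_eq_max; congr (_, _).
by case: eqP => // _; apply/ffunP => i; rewrite !ffunE ord_predK.
Qed.

Lemma ordS_neq j : ordS j != j.
Proof.
by apply/eqP => /(congr1 val); rewrite val_ordS; case: eqP => [->|_] /=; lia.
Qed.

Lemma ordS_neq_pred j : ordS j != ord_pred j.
Proof.
apply/eqP => /(congr1 val); rewrite val_ordS val_ord_pred -!val_eqE /=.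
by have := ltn_ord j; do 2 case: eqP => /=; lia.
Qed.

Variant cadj_spec v u : bool + bits -> bool + bits -> Prop :=
| CadjNext of u = next v : cadj_spec v u (inl true) (inl false)
| CadjPrev of u = prev v : cadj_spec v u (inl false) (inl true)
| CadjChord of chord v u : cadj_spec v u (inr (xor v.2 u.2)) (inr (xor v.2 u.2)).

Lemma next_neq_prev v : next v != prev v.
Proof. by apply/eqP => /(congr1 fst) /eqP /=; rewrite (negPf (ordS_neq_pred _)). Qed.

Lemma xorC x y : xor x y = xor y x.
Proof. by apply/ffunP => i; rewrite !ffunE addbC. Qed.

Lemma xorK x y : xor x (xor x y) = y.
Proof. by apply/ffunP => i; rewrite !ffunE addKb. Qed.

Lemma chordC v u : chord v u = chord u v.
Proof. by rewrite /chord andbCA [v.2 == _]eq_sym [v.2 _ && _]andbC. Qed.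

Lemma clab_next v : clab v (next v) = inl true.
Proof. by rewrite /clab eqxx. Qed.

Lemma clab_prev v : clab v (prev v) = inl false.
Proof. by rewrite /clab eq_sym (negPf (next_neq_prev v)) eqxx. Qed.

Lemma cadjP v u : cadj v u -> cadj_spec v u (clab v u) (clab u v).
Proof.
case/or3P => [/eqP->|/eqP->|vu].
- have -> : clab (next v) v = inl false by rewrite -{2}[v]nextK clab_prev.
  by rewrite clab_next; apply: CadjNext.
- have -> : clab (prev v) v = inl true by rewrite -{2}[v]prevK clab_next.
  by rewrite clab_prev; apply: CadjPrev.
(* Chords stay at position 0 while cycle edges change the position, so the first two tests of [clab]
   fail on a chord. *)
have pos w w' : chord w w' -> (w' == next w) = false /\ (w' == prev w) = false.
  case/and4P => /eqP w0 /eqP w'0 _ _; split; apply/eqP => /(congr1 fst) /=.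
    by rewrite w'0 w0 => /esym /eqP; rewrite (negPf (ordS_neq _)).
  rewrite w'0 w0 => /(congr1 (@ordS _)) /eqP.
  by rewrite ord_predK (negPf (ordS_neq _)).
rewrite /clab; have [-> ->] := pos _ _ vu; rewrite chordC in vu; have [-> ->] := pos _ _ vu.
by rewrite [xor u.2 _]xorC; apply: CadjChord; rewrite chordC.
Qed.

Lemma cadj_next v : cadj v (next v). Proof. by rewrite /cadj eqxx. Qed.
Lemma cadj_prev v : cadj v (prev v). Proof. by rewrite /cadj eqxx orbT. Qed.

Lemma clab_chord v u : chord v u -> clab v u = inr (xor v.2 u.2).
Proof.
move=> vu; have vu' : cadj v u by rewrite /cadj vu !orbT.
case: (cadjP vu') vu => // ->; rewrite /chord /=; case/and4P=> /eqP-> /eqP E.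
  by have := ordS_neq ord0; rewrite E eqxx.
have := congr1 (@ordS _) E; rewrite ord_predK => /esym/eqP.
by rewrite (negPf (ordS_neq _)).
Qed.

Lemma cadj_sym : symmetric cadj.
Proof.
suff H v u : cadj v u -> cadj u v by move=> v u; apply/idP/idP; apply: H.
case/or3P => [/eqP->|/eqP->|vu].
- by rewrite -{2}[v]nextK cadj_prev.
- by rewrite -{2}[v]prevK cadj_next.
- by rewrite /cadj chordC vu !orbT.
Qed.

Lemma cadj_irr : irreflexive cadj.
Proof.
move=> v; apply/negP => /or3P[/eqP /(congr1 fst) /= /esym/eqP| |].
- by rewrite (negPf (ordS_neq _)).
- move=> /eqP /(congr1 fst) /= /(congr1 (@ordS _)) /eqP.
  by rewrite ord_predK (negPf (ordS_neq _)).
- by case/and4P=> _ _; rewrite eqxx.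
Qed.

Lemma clab_inj v u w : cadj v u -> cadj v w -> clab v u = clab v w -> u = w.
Proof.
move=> /cadjP vu /cadjP; case: vu => [->|->|vu] [->|->|vw] // [E].
move/and4P: vu => [_ /eqP u0 _ _]; move/and4P: vw => [_ /eqP w0 _ _].
by apply: injective_projections; rewrite ?u0 ?w0 // -(xorK v.2 u.2) E xorK.
Qed.

Definition cycle_graph : port_graph := label_graph cadj_sym cadj_irr clab_inj.

(** * Label sets of vertices *)

Local Notation clabels := (labels cadj clab).

(** A chord of [v] is translated to one of [v'] with the same difference. If [v'] has first bit 1,
    then so has [v]; hence the far end has first bit 0, and so has its translate. *)
Lemma clabels_sub v v' : v.1 = v'.1 ->
  (v.1 == ord0 -> v'.2 ord0 ==> v.2 ord0) -> clabels v \subset clabels v'.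
Proof.
move=> Ej Ex; apply/fintype.subsetP => c /imsetP[u vu ->].
case: (cadjP vu) => [_|_|/and4P[v0 u0 vNu marks]].
- by rewrite -(clab_next v') lab_labels ?cadj_next.
- by rewrite -(clab_prev v') lab_labels ?cadj_prev.
pose u' : cvertex := (ord0, xor v'.2 (xor v.2 u.2)).
have vu' : chord v' u'.
  rewrite /chord -Ej v0 /=; apply/andP; split.
    apply: contra vNu => /eqP E; apply/eqP/ffunP => i.
    have /ffunP /(_ i) := E; rewrite !ffunE.
    by case: (v'.2 i) (v.2 i) (u.2 i) => [] [] [].
  rewrite !ffunE; move: (Ex v0) marks.
  by case: (v'.2 _) (v.2 _) (u.2 _) => [] [] [].
have <- : clab v' u' = inr (xor v.2 u.2) by rewrite clab_chord //= xorK.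
by rewrite lab_labels // /cadj vu' !orbT.
Qed.

Lemma clabels_eq v v' : v.1 = v'.1 ->
  (v.1 == ord0 -> v.2 ord0 = v'.2 ord0) -> clabels v = clabels v'.
Proof.
move=> Ej Ex; apply/eqP; rewrite finset.eqEsubset !clabels_sub // -?Ej //.
  by move=> /Ex ->; apply: implybb.
by move=> /Ex ->; apply: implybb.
Qed.

(** * Depth of bits and equality of truncated views *)

Definition bit_index i j := i * M + j.
(** The distance to the pair [(ord0, ord0)] along the cycle of pairs. *)
Definition bit_depth i j := minn (bit_index i j) (K * M - bit_index i j).

Lemma bit_index_prev i j d : bit_index i j = d.+1 ->
  bit_index (if j == ord0 then ord_pred i else i) (ord_pred j) = d.
Proof.
rewrite /bit_index; have := val_ord_pred j; have := val_ord_pred i => /= Ei ->.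
case: eqP => [-> /=|/eqP]; last by rewrite -val_eqE /=; nia.
by rewrite Ei -val_eqE /=; case: (nat_of_ord i) => [|i'] //=; nia.
Qed.

(** The left side is the depth, before the step, of the bit found in place [i] after it. The pair
    moves one place on a cycle of length [K * M], so its cyclic distance changes by at most one. *)
Lemma bit_depth_next i j :
  bit_depth (if j == ord_max then ord_pred i else i) j <=
  (bit_depth i (ordS j)).+1.
Proof.
rewrite /bit_depth /bit_index.
have := ltn_ord i; have := ltn_ord j.
have := val_ordS j; have := val_ord_pred i => /= Ei ->.
case: eqP => [-> _|/eqP]; last first.
  by rewrite -val_eqE /= => jM jlt ilt; nia.
rewrite /= Ei -val_eqE /=; case: (nat_of_ord i) => [|i'] //= ilt; nia.
Qed.

Lemma bit_depth_prev i j :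
  bit_depth (if j == ord0 then ordS i else i) j <= (bit_depth i (ord_pred j)).+1.
Proof.
rewrite /bit_depth /bit_index.
have := ltn_ord i; have := ltn_ord j; have := val_ord_pred j => /= ->.
case: eqP => [-> _ /=|/eqP]; last first.
  by rewrite -val_eqE /= => j0 jlt ilt; nia.
have [->|iM] := eqVneq i ord_max; first by rewrite modnn /=; nia.
rewrite -val_eqE /= in iM => ilt; rewrite modn_small; last by lia.
nia.
Qed.

Definition agree l v v' :=
  v.1 = v'.1 /\ forall i, bit_depth i v.1 <= l -> v.2 i = v'.2 i.

Lemma agree_labels l v v' : agree l v v' -> clabels v = clabels v'.
Proof.
case=> Ej Ex; apply: clabels_eq => // /eqP v0; apply: Ex.
by rewrite v0 /bit_depth /bit_index min0n.
Qed.

Lemma agree_next l v v' : agree l.+1 v v' -> agree l (next v) (next v').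
Proof.
case: v v' => j x [_ x'] [/= <- Ex]; split=> //= i; rewrite -ltnS => le_l.
have := Ex _ (leq_trans (bit_depth_next i j) le_l).
by case: ifP => //= _; rewrite !ffunE.
Qed.

Lemma agree_prev l v v' : agree l.+1 v v' -> agree l (prev v) (prev v').
Proof.
case: v v' => j x [_ x'] [/= <- Ex]; split=> //= i; rewrite -ltnS => le_l.
have := Ex _ (leq_trans (bit_depth_prev i j) le_l).
by case: ifP => //= _; rewrite !ffunE.
Qed.

(** A cycle edge changes the depth of each bit by at most one, and a chord adds the same difference
    to both strings without moving any bit. *)
Lemma agree_view_iso l v v' : agree l v v' ->
  tree_iso (truncated_view l (v : cycle_graph))
    (truncated_view l (v' : cycle_graph)).
Proof.
apply: truncated_view_iso => {l v v'} [l v v' /agree_labels Lv|].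
  by rewrite -!(card_labels clab_inj) Lv.
move=> l v v' u u' vv' vu v'u' E.
have {E} := label_port_lab (agree_labels vv') vu v'u' E.
suff H : clab v u = clab v' u' -> clab u v = clab u' v' /\ agree l u u'.
  move=> /H[E uu']; split=> //=.
  by rewrite /label_port E (agree_labels uu').
case: (cadjP vu) => [->|->|c]; case: (cadjP v'u') => [->|->|c'] // E.
- by split=> //; apply: agree_next.
- by split=> //; apply: agree_prev.
case/and4P: c => /eqP v0 /eqP u0 _ _; case/and4P: c' => /eqP v'0 /eqP u'0 _ _.
split=> //; case: E => E; split=> [|i]; first by rewrite u0.
rewrite u0 -v0 => /leqW /vv'.2 Exi; have /ffunP /(_ i) := E; rewrite !ffunE Exi.
exact: addbI.
Qed.

(** * Recovering the string from the full view *)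

Lemma cycle_mark_iso v v' : v.1 = v'.1 ->
  tree_iso (view (v : cycle_graph)) (view (v' : cycle_graph)) ->
  v.1 == ord0 -> v.2 ord0 = v'.2 ord0.
Proof.
suff H w w' : w.1 = w'.1 -> #|clabels w| = #|clabels w'| ->
    w.1 == ord0 -> w.2 ord0 -> w'.2 ord0.
  move=> Ej /view_iso_degree; rewrite -!(card_labels clab_inj) => card_eq v0.
  by apply/idP/idP; apply: H => //; rewrite -Ej.
move=> Ew card_w w0 m0; apply/negPn/negP => m'0.
(* The labels of a vertex with first bit 1 lie among those of one with first bit 0; equal
   cardinality turns the inclusion into equality. *)
have Lw : clabels w = clabels w'.
  apply/eqP; rewrite finset.eqEcard card_w leqnn andbT clabels_sub //.
  by rewrite (negPf m'0).
(* Flipping only the last bit, which is not the first as [2 <= K], is allowed from [w'] but would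
   join [w] to another string with first bit 1. *)
pose u : cvertex := (ord0, xor w'.2 [ffun i => i == ord_max]).
have w'u : chord w' u.
  rewrite /chord -Ew w0 (negPf m'0) andbT; apply/eqP => /ffunP /(_ ord_max).
  by rewrite !ffunE eqxx; case: (w'.2 _).
have : clab w' u \in clabels w by rewrite Lw lab_labels // /cadj w'u !orbT.
rewrite clab_chord // xorK => /imsetP[u' wu'].
case: (cadjP wu') => // /and4P[_ _ _]; rewrite m0 /= => u'0 [/ffunP /(_ ord0)].
by rewrite !ffunE m0 (negPf u'0).
Qed.

(** Walking backwards lowers the index of a chosen bit by one until it is the first bit at position
    0, where the degree reveals it. *)
Lemma cycle_view_iso v v' : v.1 = v'.1 ->
  tree_iso (view (v : cycle_graph)) (view (v' : cycle_graph)) -> v.2 = v'.2.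
Proof.
move=> Ej iso; apply/ffunP => i.
move: {-1}(bit_index i v.1) (erefl (bit_index i v.1)) => d.
elim: d v v' i Ej iso => [|d IH] v v' i Ej iso Ed.
  have [i0 v0] : i = ord0 /\ v.1 = ord0.
    by move: Ed; rewrite /bit_index => Ed; split; apply: val_inj => /=; nia.
  by rewrite i0; apply: cycle_mark_iso iso _ => //; apply/eqP.
have Lv : clabels v = clabels v'.
  by apply: clabels_eq => // /(cycle_mark_iso Ej iso).
have [u [v'u Ep iso']] :=
  view_iso_step iso (cadj_prev v : @adj cycle_graph v (prev v)).
(* The matched neighbour is reached by the label [inl false], so it is [prev v']. *)
have /esym := label_port_lab (esym Lv) v'u (cadj_prev v) Ep; rewrite clab_prev.
case: (cadjP v'u) iso' => // -> iso' _.
have := IH (prev v) (prev v') (if v.1 == ord0 then ord_pred i else i) _ iso'.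
rewrite /prev /= -Ej => /(_ erefl (bit_index_prev Ed)).
by case: eqP => // _; rewrite !ffunE ord_predK.
Qed.

Lemma agree_flip i j t : t < bit_depth i j ->
  agree t (j, [ffun=> false]) (j, [ffun i' => i' == i]).
Proof.
move=> lt_t; split=> //= i'; rewrite !ffunE; case: eqP => // -> le_t.
by have := leq_trans lt_t le_t; rewrite ltnn.
Qed.

Lemma bit_depth_antipode : exists i j, bit_depth i j = (K * M)./2.
Proof.
(* Quotient and remainder by [M] give the pair of index [(K * M)./2], opposite to the origin. *)
have iK : (K * M)./2 %/ M < K by rewrite ltn_divLR //; nia.
exists (Ordinal iK), (Ordinal (ltn_pmod (K * M)./2 (isT : 0 < M))).
by rewrite /bit_depth /bit_index /= -divn_eq; lia.
Qed.

(** * Distances and order of the cycle graph *)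

Lemma within_spoke j x :
  within j ((j, x) : cycle_graph) (ord0, x) /\
  within j ((ord0, x) : cycle_graph) (j, x).
Proof.
case: j => j; elim: j => [|j IH] jM.
  by rewrite (_ : Ordinal jM = ord0); [split; apply: within0|apply: val_inj].
(* A step back from a positive position does not rotate the string. *)
have E : (Ordinal (ltnW jM), x) = prev (Ordinal jM, x).
  congr (_, _); apply: val_inj; have := val_ord_pred (Ordinal jM).
  by rewrite -val_eqE /= => ->.
have [down up] := IH (ltnW jM); split=> /=.
  apply: (@within_trans _ 1 j _ _ _ _ down); apply: within1.
  by rewrite E; apply: cadj_prev.
apply: within_leq (within_trans up (within1 _)); first by rewrite addn1.
by rewrite E /= cadj_sym; apply: cadj_prev.
Qed.

Lemma within_hub x y : within 2 ((ord0, x) : cycle_graph) (ord0, y).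
Proof.
have [->|xNy] := eqVneq x y; first exact: within_leq (within0 _).
have hub (z w : bits) : z != w -> ~~ (z ord0 && w ord0) ->
    within 1 ((ord0, z) : cycle_graph) (ord0, w).
  by move=> zw mk; apply: within1; rewrite /= /cadj /chord /= zw mk !orbT.
have [/andP[x0 y0]|mk] := boolP (x ord0 && y ord0); last first.
  exact: within_leq (hub _ _ xNy mk).
(* Two strings whose first bits are both 1 are connected through the zero string. *)
have N0 (z : bits) : z ord0 -> z != [ffun=> false].
  by move=> z0; apply/eqP => /ffunP /(_ ord0); rewrite ffunE z0.
pose z : bits := [ffun=> false].
apply: (@within_trans cycle_graph 1 1 (ord0, x) (ord0, z) (ord0, y)); apply: hub.
- exact: N0.
- by rewrite ffunE andbF.
- by rewrite eq_sym N0.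
- by rewrite ffunE.
Qed.

Lemma within_cycle (u v : cycle_graph) : within M.*2 u v.
Proof.
case: u v => [j x] [j' y].
have [down _] := within_spoke j x; have [_ up] := within_spoke j' y.
apply: within_leq (within_trans down (within_trans (within_hub x y) up)).
by have := ltn_ord j; have := ltn_ord j'; lia.
Qed.

Lemma card_cycle : #|cycle_graph| = M * 2 ^ K.
Proof. by rewrite /= card_prod card_ord card_ffun card_bool card_ord. Qed.

End CycleGraph.

(** * The case of small diameter *)

Section StarGraph.

Definition star_adj : rel 'I_3 :=
  fun u v => (u != v) && ((u == ord0) || (v == ord0)).

Lemma star_adj_sym : symmetric star_adj.
Proof. by move=> u v; rewrite /star_adj eq_sym orbC. Qed.

Lemma star_adj_irr : irreflexive star_adj.
Proof. by move=> u; rewrite /star_adj eqxx. Qed.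

Definition star_graph : port_graph :=
  label_graph (lab := fun _ u => u) star_adj_sym star_adj_irr (fun _ _ _ _ _ E => E).

Lemma within_star (u v : star_graph) : within 2 u v.
Proof.
have hub (w w' : star_graph) : (w == ord0) || (w' == ord0) -> within 1 w w'.
  have [-> _|ww' w0] := eqVneq w w'; first exact: within_leq (within0 _).
  by apply: within1; rewrite /= /star_adj ww'.
by apply: (@within_trans star_graph 1 1 u ord0 v); apply: hub; rewrite eqxx ?orbT.
Qed.

Lemma star_view_neq :
  ~ tree_iso (view (ord0 : star_graph)) (view (ord_max : star_graph)).
Proof.
have c0 : #|star_adj ord0| = 2.
  apply: (@etrans _ _ #|predC1 (ord0 : 'I_3)|); last by rewrite cardC1 card_ord.
  by apply: eq_card => u; rewrite !unfold_in /star_adj /= andbT eq_sym.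
have c1 : #|star_adj ord_max| = 1.
  apply: etrans (card1 (ord0 : 'I_3)); apply: eq_card => u.
  by rewrite !unfold_in /star_adj /=; case: (eqVneq u ord0) => [->|_]; rewrite ?andbF.
by move/view_iso_degree; rewrite [LHS]c0 [RHS]c1.
Qed.

End StarGraph.

(** * Choice of the parameters and the final estimate *)

Local Open Scope ring_scope.

Theorem theorem3p1 (R : realType) (D n : nat)
    (D_ge3 : (3 <= D)%N) (n_ge1 : (1 <= n)%N)
    (n_large : D%:R * 2 ^+ 12 / 3 <= n%:R :> R) :
  exists G : port_graph,
    [/\ connected_graph G, (#|G| <= n)%N, (diameter G <= D)%N &
      exists a b : G,
        ~ tree_iso (view a) (view b) /\
        forall t : nat,
          t%:R <= (D%:R - 5) / 6 * log2 (n%:R / D%:R) - 41 / 100 * D%:R :> R ->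
          tree_iso (truncated_view t a) (truncated_view t b)].
Proof.
have Dn : (D * 4096 <= 3 * n)%N.
  have E : (2 ^+ 12 : R) = 4096%:R by rewrite -natrX.
  by rewrite -(ler_nat R) !natrM -E; lra.
have D_gt0 : 0 < D%:R :> R by rewrite ltr0n; lia.
have n_gt0 : 0 < n%:R :> R by rewrite ltr0n.
have ln2_gt0 : 0 < ln 2 :> R by rewrite ln_gt0 ?ltr1n.
(* For [D < 6] the cycle length [D./2] would be below 3. The bound on [t] is then negative, so any
   two vertices with different views suffice. *)
have [D_small|D_ge6] := ltnP D 6.
  exists star_graph; split.
  - exact: within_connected within_star.
  - by rewrite /= card_ord; lia.
  - by apply: leq_trans (within_diameter within_star) _; lia.
  exists ord0, ord_max; split=> [|t le_t]; first exact: star_view_neq.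
  have log_ge0 : 0 <= log2 (n%:R / D%:R) :> R.
    apply: divr_ge0 (ltW ln2_gt0); rewrite ln_ge0 // ler_pdivlMr // mul1r ler_nat.
    by lia.
  have D5 : D%:R <= 5 :> R by rewrite ler_nat.
  have : 0 <= t%:R :> R by [].
  suff : (D%:R - 5) / 6 * log2 (n%:R / D%:R) <= 0 :> R by lra.
  by rewrite mulr_le0_ge0 //; lra.
have [m Em] : exists m, (D./2 = m.+3)%N by exists (D./2 - 3)%N; lia.
(* The cycle has length [D./2] to keep the diameter within [D]; [K] is the largest number of bits
   for which [D./2 * 2 ^ K] vertices fit into [n]. *)
pose K := trunc_log 2 (n %/ D./2).
have nM : (4 <= n %/ D./2)%N by rewrite leq_divRL; lia.
have [k Ek] : exists k, (K = k.+2)%N.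
  have : (2 <= K)%N by apply: trunc_log_max.
  by exists (K - 2)%N; lia.
have le_n : (D./2 * 2 ^ K <= n)%N.
  rewrite mulnC -leq_divRL; last by lia.
  by apply: trunc_logP => //; lia.
(* Maximality of [K] gives [n < D./2 * 2 ^ K.+1], and [D./2] is at most half of [D]. *)
have n_le : (n <= D * 2 ^ K)%N.
  have : (n %/ D./2 < 2 ^ K.+1)%N by apply: trunc_log_ltn.
  rewrite ltn_divLR ?expnS; last by lia.
  by move: (2 ^ K)%N => P; nia.
have log_le : log2 (n%:R / D%:R) <= K%:R :> R.
  rewrite /log2 ler_pdivrMr // [K%:R * _]mulr_natl -lnXn // ler_ln ?posrE ?divr_gt0 ?exprn_gt0 //.
  by rewrite ler_pdivrMr // mulrC -natrX -natrM ler_nat.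
exists (cycle_graph m k); split.
- exact: within_connected (@within_cycle m k).
- by rewrite card_cycle -Em -Ek.
- by apply: leq_trans (within_diameter (@within_cycle m k)) _; lia.
have [i [j Eij]] := bit_depth_antipode m k.
exists (j, [ffun=> false]), (j, [ffun i' => i' == i]); split.
  by move=> /cycle_view_iso => /(_ erefl) /ffunP /(_ i); rewrite !ffunE eqxx.
move=> t le_t; apply/agree_view_iso/agree_flip; rewrite Eij -Em -Ek.
(* The summand 2 provides both the strict inequality and the rounding in [(K * D./2)./2]. *)
suff : (2 * t + 2 <= K * D./2)%N by lia.
have D6 : 6 <= D%:R :> R by rewrite ler_nat.
have DM : D%:R <= 2 * (D./2)%:R + 1 :> R.
  by rewrite -natrM natr1 ler_nat; lia.
rewrite -(ler_nat R) natrD !natrM.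
have K_ge0 : 0 <= K%:R :> R by [].
have : (D%:R - 5) / 6 * log2 (n%:R / D%:R) <= (D%:R - 5) / 6 * K%:R :> R.
  by rewrite ler_wpM2l //; lra.
(* Here [(D - 5) / 3 <= (D - 1) / 2 <= D./2] in the reals, and [82 / 100 * D] exceeds 2 because
   [6 <= D]. *)
nra.
Qed.
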